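(* There exists a symmetric monoidal category $\mathsf{Learn}$ whose objects are sets and whose morphisms $A\to B$ are equivalence classes of learners $A\to B$, with composition, identities, monoidal product and braiding given (on representatives) by the formulas in the context.
   Context: For sets $A,B$, a (supervised learning algorithm or) learner $A\to B$ is a tuple $(P,I,U,r)$ where $P$ is a set and $I\colon P\times A\to B$ (implementation), $U\colon P\times A\times B\to P$ (update), $r\colon P\times A\times B\to A$ (request) are functions. Learners $(P,I,U,r)$ and $(P',I',U',r')$ of type $A\to B$ are equivalent if there is a bijection $f\colon P\to P'$ such that for all $p\in P,a\in A,b\in B$: $I'(f(p),a)=I(p,a)$, $U'(f(p),a,b)=f(U(p,a,b))$, $r'(f(p),a,b)=r(p,a,b)$. Structure: - Composition of $(P,I,U,r)\colon A\to B$ and $(Q,J,V,s)\colon B\to C$: $(P\times Q, I\ast J,U\ast V,r\ast s)\colon A\to C$ with $(I\ast J)(p,q,a)=J(q,I(p,a))$, $(U\ast V)(p,q,a,c)=\big(U(p,a,s(q,I(p,a),c)),\,V(q,I(p,a),c)\big)$, $(r\ast s)(p,q,a,c)=r(p,a,s(q,I(p,a),c))$. - Identity on $A$: $(\mathbb{R}^0,\mathrm{id},!,\pi_2)$ where $\mathrm{id}\colon\mathbb{R}^0\times A\to A$ is the projection, $!\colon\mathbb{R}^0\times A\times A\to\mathbb{R}^0$ is the unique map, and $\pi_2\colon\mathbb{R}^0\times A\times A\to A$ is the projection onto the final factor. - Monoidal product: on objects the cartesian product $A\times B$ of sets (unit: the one-element set); for $(P,I,U,r)\colon A\to B$ and $(Q,J,V,s)\colon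 C\to D$ it is $(P\times Q,I\parallel J,U\parallel V,r\parallel s)\colon A\times C\to B\times D$ with $(I\parallel J)(p,q,a,c)=(I(p,a),J(q,c))$, $(U\parallel V)(p,q,a,c,b,d)=(U(p,a,b),V(q,c,d))$, $(r\parallel s)(p,q,a,c,b,d)=(r(p,a,b),s(q,c,d))$. - Braiding $A\times B\to B\times A$: $(\mathbb{R}^0,\sigma,!,\sigma\circ\pi)$, where $\sigma$ denotes the swap function and $\pi\colon\mathbb{R}^0\times(A\times B)\times(B\times A)\to B\times A$ is the projection onto the final factor (so the request function sends $((a,b),(b',a'))$ to $(a',b')$). *)

(* Defs.v *)
(* MathComp, with the real numbers R of Stdlib. *)
From Stdlib Require Import Rdefinitions.
From mathcomp Require Import all_boot all_algebra.

Set Implicit Arguments.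
Unset Strict Implicit.
Unset Printing Implicit Defensive.

(** * Symmetric monoidal categories

   The objects, the morphisms, and the action of the monoidal product on
   objects are parameters of the structures, so that they can be prescribed
   without equations between types.  Composition is in diagrammatic order:
   [compose f g] is "first f, then g". *)

Record category (Ob : Type) (Hom : Ob -> Ob -> Type) := Category {
  idm : forall A, Hom A A;
  compose : forall A B C, Hom A B -> Hom B C -> Hom A C;
  comp_idl : forall A B (f : Hom A B), compose (idm A) f = f;
  comp_idr : forall A B (f : Hom A B), compose f (idm B) = f;
  comp_assoc : forall A B C D (f : Hom A B) (g : Hom B C) (h : Hom C D),
    compose (compose f g) h = compose f (compose g h)
}.
Arguments idm {Ob Hom} c A.
Arguments compose {Ob Hom} c {A B C} f g.

Definition isomorphism (Ob : Type) (Hom : Ob -> Ob -> Type)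
    (K : category Hom) (A B : Ob) (f : Hom A B) : Prop :=
  exists g : Hom B A, compose K f g = idm K A /\ compose K g f = idm K B.

Record monoidal_structure (Ob : Type) (Hom : Ob -> Ob -> Type) (K : category Hom)
    (one : Ob) (prd : Ob -> Ob -> Ob) := Monoidal {
  tensor : forall A B C D, Hom A B -> Hom C D -> Hom (prd A C) (prd B D);
  associator : forall A B C, Hom (prd (prd A B) C) (prd A (prd B C));
  lunitor : forall A, Hom (prd one A) A;
  runitor : forall A, Hom (prd A one) A;
  tensor_id : forall A B,
    tensor (idm K A) (idm K B) = idm K (prd A B);
  tensor_comp : forall A B C A' B' C' (f : Hom A B) (g : Hom B C)
      (f' : Hom A' B') (g' : Hom B' C'),
    tensor (compose K f g) (compose K f' g')
    = compose K (tensor f f') (tensor g g');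
  associator_iso : forall A B C, isomorphism K (associator A B C);
  lunitor_iso : forall A, isomorphism K (lunitor A);
  runitor_iso : forall A, isomorphism K (runitor A);
  associator_natural : forall A A' B B' C C'
      (f : Hom A A') (g : Hom B B') (h : Hom C C'),
    compose K (tensor (tensor f g) h) (associator A' B' C')
    = compose K (associator A B C) (tensor f (tensor g h));
  lunitor_natural : forall A B (f : Hom A B),
    compose K (tensor (idm K one) f) (lunitor B) = compose K (lunitor A) f;
  runitor_natural : forall A B (f : Hom A B),
    compose K (tensor f (idm K one)) (runitor B) = compose K (runitor A) f;
  triangle : forall A B,
    compose K (associator A one B) (tensor (idm K A) (lunitor B))
    = tensor (runitor A) (idm K B);
  pentagon : forall A B C D,
    compose K (associator (prd A B) C D) (associator A B (prd C D))
    = compose K (tensor (associator A B C) (idm K D))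
        (compose K (associator A (prd B C) D)
                (tensor (idm K A) (associator B C D)))
}.
Arguments tensor {Ob Hom K one prd} m {A B C D} f g.
Arguments associator {Ob Hom K one prd} m A B C.
Arguments lunitor {Ob Hom K one prd} m A.
Arguments runitor {Ob Hom K one prd} m A.

(* By [braid_sym] each braiding is an isomorphism and the second hexagon
   follows from the first. *)
Record symmetric_structure (Ob : Type) (Hom : Ob -> Ob -> Type) (K : category Hom)
    (one : Ob) (prd : Ob -> Ob -> Ob) (M : monoidal_structure K one prd) := Symmetric {
  braid : forall A B, Hom (prd A B) (prd B A);
  braid_natural : forall A A' B B' (f : Hom A A') (g : Hom B B'),
    compose K (tensor M f g) (braid A' B') = compose K (braid A B) (tensor M g f);
  braid_sym : forall A B, compose K (braid A B) (braid B A) = idm K (prd A B);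
  hexagon : forall A B C,
    compose K (associator M A B C)
      (compose K (braid A (prd B C)) (associator M B C A))
    = compose K (tensor M (braid A B) (idm K C))
        (compose K (associator M B A C) (tensor M (idm K B) (braid A C)))
}.
Arguments braid {Ob Hom K one prd M} s A B.

(** * Learners *)

(* A single universe of sets, shared by the objects and by the parameter
   spaces of the learners. *)
Definition Sets := Type.

Definition oneset : Sets := unit.
Definition setprod (A B : Sets) : Sets := (A * B)%type.

(* The functions are curried. *)
Record learner (A B : Sets) := Learner {
  param : Sets;
  impl : param -> A -> B;
  update : param -> A -> B -> param;
  request : param -> A -> B -> A
}.

Definition learner_equiv (A B : Sets) (l l' : learner A B) : Prop :=
  exists f : param l -> param l',
    bijective f /\
    forall (p : param l) (a : A) (b : B),
      [/\ impl (f p) a = impl p a,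
          update (f p) a b = f (update p a b)
        & request (f p) a b = request p a b].

(* Equivalence classes of learners, as subsets of [learner A B]. *)
Definition learner_class (A B : Sets) : Type :=
  {X : learner A B -> Prop | exists l, X = learner_equiv l}.

Definition classof (A B : Sets) (l : learner A B) : learner_class A B :=
  exist _ (learner_equiv l) (ex_intro _ l erefl).

Definition learner_comp (A B C : Sets) (l : learner A B) (m : learner B C) :
    learner A C :=
  @Learner A C (setprod (param l) (param m))
    (fun pq a => impl pq.2 (impl pq.1 a))
    (fun pq a c =>
       (update pq.1 a (request pq.2 (impl pq.1 a) c),
        update pq.2 (impl pq.1 a) c))
    (fun pq a c => request pq.1 a (request pq.2 (impl pq.1 a) c)).

Definition Rpow0 : Sets := 'rV[R]_0.
Definition Rpow0_pt : Rpow0 := const_mx R0.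

Definition learner_id (A : Sets) : learner A A :=
  @Learner A A Rpow0 (fun _ a => a) (fun _ _ _ => Rpow0_pt) (fun _ _ b => b).

Definition learner_tensor (A B C D : Sets)
    (l : learner A B) (m : learner C D) :
    learner (setprod A C) (setprod B D) :=
  @Learner (setprod A C) (setprod B D) (setprod (param l) (param m))
    (fun pq ac => (impl pq.1 ac.1, impl pq.2 ac.2))
    (fun pq ac bd => (update pq.1 ac.1 bd.1, update pq.2 ac.2 bd.2))
    (fun pq ac bd => (request pq.1 ac.1 bd.1, request pq.2 ac.2 bd.2)).

Definition swap (A B : Sets) (x : setprod A B) : setprod B A := (x.2, x.1).

Definition learner_braid (A B : Sets) :
    learner (setprod A B) (setprod B A) :=
  @Learner (setprod A B) (setprod B A) Rpow0
    (fun _ ab => swap ab) (fun _ _ _ => Rpow0_pt) (fun _ _ ba => swap ba).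

(* Main.v *)
(** Equivalent learners have isomorphic parameter spaces, so each axiom reduces
    to an evident bijection of products of parameter spaces, compatible with the
    implementation, update and request functions.  The associator, the unitors
    and the braiding come from pairs of mutually inverse functions with a
    one-point parameter space; sending such a pair to its class preserves
    composition and products, so the coherence diagrams are inherited from the
    cartesian structure of sets. *)
Require Import Defs.
From mathcomp Require Import all_boot matrix.
From mathcomp Require Import boolp.

Set Implicit Arguments.
Unset Strict Implicit.
Unset Printing Implicit Defensive.

(** * Equivalence classes *)

Lemma learner_equiv_refl (A B : Sets) (l : learner A B) : learner_equiv l l.
Proof. by exists id; split=> //; exists id. Qed.

Lemma learner_equiv_sym (A B : Sets) (l m : learner A B) :
  learner_equiv l m -> learner_equiv m l.
Proof.
case=> f [[g fK gK] fE]; exists g; split; first by exists f.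
move=> p a b; have [<- Eu <-] := fE (g p) a b.
by rewrite gK in Eu *; split=> //; rewrite Eu fK.
Qed.

Lemma learner_equiv_trans (A B : Sets) (l m n : learner A B) :
  learner_equiv l m -> learner_equiv m n -> learner_equiv l n.
Proof.
case=> f [bij_f fE] [g [bij_g gE]]; exists (g \o f); split.
  exact: bij_comp.
move=> p a b /=; have [Ei Eu Er] := fE p a b.
by have [-> -> ->] := gE (f p) a b; rewrite Ei Eu Er.
Qed.

(** By symmetry and transitivity the two predicates have the same members, so extensionality makes
    them equal. Proof irrelevance takes care of the witness that each is a class. *)
Lemma classof_eq (A B : Sets) (l m : learner A B) :
  learner_equiv l m -> classof l = classof m.
Proof.
move=> lm; apply: eq_exist; apply/predeqP => n; split.
  exact/learner_equiv_trans/learner_equiv_sym.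
exact: learner_equiv_trans.
Qed.

Lemma classof_eqP (A B : Sets) (l m : learner A B) :
  classof l = classof m -> learner_equiv l m.
Proof.
move=> /(congr1 sval) /= E; rewrite E; exact: learner_equiv_refl.
Qed.

(** Representatives are picked by the axiom of choice, so that operations on classes need no lifting
    through quotients. The congruence lemmas below make the choice immaterial. *)
Definition repr (A B : Sets) (X : learner_class A B) : learner A B :=
  sval (cid (svalP X)).

Lemma reprK (A B : Sets) (X : learner_class A B) : classof (repr X) = X.
Proof. by case: X => X lX; apply: eq_exist => /=; rewrite /repr; case: cid. Qed.

Lemma repr_classof (A B : Sets) (l : learner A B) :
  learner_equiv (repr (classof l)) l.
Proof. by apply: classof_eqP; rewrite reprK. Qed.

(** The product of the two parameter bijections works, since the intermediate values in [B] and the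
    requests sent back to [B] agree. *)
Lemma learner_comp_equiv (A B C : Sets) (l l' : learner A B)
    (m m' : learner B C) :
  learner_equiv l l' -> learner_equiv m m' ->
  learner_equiv (learner_comp l m) (learner_comp l' m').
Proof.
case=> f [[f' fK f'K] fE] [g [[g' gK g'K] gE]].
exists (fun p => (f p.1, g p.2)); split.
  by exists (fun p => (f' p.1, g' p.2)) => -[p q] /=; rewrite ?fK ?gK ?f'K ?g'K.
case=> p q a c /=.
(* Only the clause on [impl] is wanted, but it is quantified together with an element of [B];
   [impl p a] supplies one, as [B] might be empty. *)
have [Ei _ _] := fE p a (impl p a); rewrite Ei.
have [-> -> ->] := gE q (impl p a) c.
by have [_ -> ->] := fE p a (request q (impl p a) c).
Qed.

Lemma learner_tensor_equiv (A B C D : Sets) (l l' : learner A B)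
    (m m' : learner C D) :
  learner_equiv l l' -> learner_equiv m m' ->
  learner_equiv (learner_tensor l m) (learner_tensor l' m').
Proof.
case=> f [[f' fK f'K] fE] [g [[g' gK g'K] gE]].
exists (fun p => (f p.1, g p.2)); split.
  by exists (fun p => (f' p.1, g' p.2)) => -[p q] /=; rewrite ?fK ?gK ?f'K ?g'K.
case=> p q [a c] [b d] /=.
by have [-> -> ->] := fE p a b; have [-> -> ->] := gE q c d.
Qed.

Definition class_comp (A B C : Sets) (X : learner_class A B)
    (Y : learner_class B C) : learner_class A C :=
  classof (learner_comp (repr X) (repr Y)).

Definition class_tensor (A B C D : Sets) (X : learner_class A B)
    (Y : learner_class C D) : learner_class (setprod A C) (setprod B D) :=
  classof (learner_tensor (repr X) (repr Y)).

Lemma class_compE (A B C : Sets) (l : learner A B) (m : learner B C) :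
  class_comp (classof l) (classof m) = classof (learner_comp l m).
Proof. by apply/classof_eq/learner_comp_equiv; apply: repr_classof. Qed.

Lemma class_tensorE (A B C D : Sets) (l : learner A B) (m : learner C D) :
  class_tensor (classof l) (classof m) = classof (learner_tensor l m).
Proof. by apply/classof_eq/learner_tensor_equiv; apply: repr_classof. Qed.

(** * Parameter-free learners *)

(** A row of length 0 has no entries to compare. *)
Lemma Rpow0_eq (p : Rpow0) : Rpow0_pt = p.
Proof. by apply/matrixP => i []. Qed.

(** A morphism from [A] to [B] in the product of the category of sets with its opposite: [f] and [g]
    need not be inverse to each other. Identities, braidings, unitors and associators are all of
    this form. *)
Definition learner_pure (A B : Sets) (f : A -> B) (g : B -> A) : learner A B :=
  @Learner A B Rpow0 (fun _ => f) (fun _ _ _ => Rpow0_pt) (fun _ _ => g).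

Definition pure (A B : Sets) (f : A -> B) (g : B -> A) : learner_class A B :=
  classof (learner_pure f g).

Lemma eq_pure (A B : Sets) (f f' : A -> B) (g g' : B -> A) :
  f =1 f' -> g =1 g' -> pure f g = pure f' g'.
Proof. by move=> /funext -> /funext ->. Qed.

Lemma pure_comp (A B C : Sets) (f : A -> B) (g : B -> A)
    (h : B -> C) (k : C -> B) :
  class_comp (pure f g) (pure h k) = pure (h \o f) (g \o k).
Proof.
rewrite class_compE.
apply: classof_eq; exists (fun=> Rpow0_pt); split=> //.
exists (fun=> (Rpow0_pt, Rpow0_pt)); last exact: Rpow0_eq.
by case=> p q; rewrite -(Rpow0_eq p) -(Rpow0_eq q).
Qed.

Lemma pure_tensor (A B C D : Sets) (f : A -> B) (g : B -> A)
    (h : C -> D) (k : D -> C) :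
  class_tensor (pure f g) (pure h k)
  = @pure (setprod A C) (setprod B D)
      (fun x => (f x.1, h x.2)) (fun y => (g y.1, k y.2)).
Proof.
rewrite class_tensorE.
apply: classof_eq; exists (fun=> Rpow0_pt); split=> //.
exists (fun=> (Rpow0_pt, Rpow0_pt)); last exact: Rpow0_eq.
by case=> p q; rewrite -(Rpow0_eq p) -(Rpow0_eq q).
Qed.

(** Dropping the one-point factor keeps the parameter space of [l], so that later bijections need
    not mention it. *)
Lemma comp_purel (A B C : Sets) (f : A -> B) (g : B -> A) (l : learner B C) :
  class_comp (pure f g) (classof l)
  = classof (@Learner A C (param l) (fun p a => impl p (f a))
      (fun p a c => update p (f a) c) (fun p a c => g (request p (f a) c))).
Proof.
rewrite class_compE.
apply: classof_eq; exists snd; split=> //.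
exists (pair Rpow0_pt) => //.
by case=> p q; rewrite -(Rpow0_eq p).
Qed.

Lemma comp_purer (A B C : Sets) (l : learner A B) (f : B -> C) (g : C -> B) :
  class_comp (classof l) (pure f g)
  = classof (@Learner A C (param l) (fun p a => f (impl p a))
      (fun p a c => update p a (g c)) (fun p a c => request p a (g c))).
Proof.
rewrite class_compE.
apply: classof_eq; exists fst; split=> //.
exists (pair^~ Rpow0_pt) => //.
by case=> p q; rewrite -(Rpow0_eq q).
Qed.

Definition class_id (A : Sets) : learner_class A A := pure id id.

(** * The category of learners *)

(** Once the identity is absorbed, what remains is the representative with its fields expanded;
    destructing the record identifies the two. *)
Lemma class_comp_idl (A B : Sets) (X : learner_class A B) :
  class_comp (class_id A) X = X.
Proof. by rewrite -(reprK X) comp_purel; case: (repr X). Qed.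

Lemma class_comp_idr (A B : Sets) (X : learner_class A B) :
  class_comp X (class_id B) = X.
Proof. by rewrite -(reprK X) comp_purer; case: (repr X). Qed.

(** On representatives the parameter spaces differ by a reassociation, so the law holds only for
    classes; the compatibility equations then hold by computation. *)
Lemma class_comp_assoc (A B C D : Sets) (X : learner_class A B)
    (Y : learner_class B C) (Z : learner_class C D) :
  class_comp (class_comp X Y) Z = class_comp X (class_comp Y Z).
Proof.
rewrite -(reprK X) -(reprK Y) -(reprK Z) !class_compE.
apply: classof_eq; exists (fun p => (p.1.1, (p.1.2, p.2))); split; last by [].
by exists (fun p => ((p.1, p.2.1), p.2.2)) => [[[? ?] ?]|[? [? ?]]].
Qed.

Definition Learn : category learner_class :=
  Category class_comp_idl class_comp_idr class_comp_assoc.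

Lemma pure_iso (A B : Sets) (f : A -> B) (g : B -> A) :
  cancel f g -> cancel g f -> isomorphism Learn (pure f g).
Proof.
by move=> fK gK; exists (pure g f); rewrite /= !pure_comp; split; apply: eq_pure.
Qed.

(** * The monoidal structure *)

Definition class_associator (A B C : Sets) :
    learner_class (setprod (setprod A B) C) (setprod A (setprod B C)) :=
  @pure (setprod (setprod A B) C) (setprod A (setprod B C))
    (fun x => (x.1.1, (x.1.2, x.2))) (fun y => ((y.1, y.2.1), y.2.2)).

Definition class_lunitor (A : Sets) : learner_class (setprod oneset A) A :=
  @pure (setprod oneset A) A snd (pair tt).

Definition class_runitor (A : Sets) : learner_class (setprod A oneset) A :=
  @pure (setprod A oneset) A fst (pair^~ tt).

Lemma class_tensor_id (A B : Sets) :
  class_tensor (class_id A) (class_id B) = class_id (setprod A B).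
Proof. by rewrite pure_tensor; apply: eq_pure => -[]. Qed.

(** The middle-four interchange, here applied to parameter spaces; its inverse is another instance
    of itself. *)
Definition interchange (A B C D : Sets) (x : setprod (setprod A B) (setprod C D)) :
    setprod (setprod A C) (setprod B D) :=
  ((x.1.1, x.2.1), (x.1.2, x.2.2)).

Lemma class_tensor_comp (A B C A' B' C' : Sets)
    (X : learner_class A B) (Y : learner_class B C)
    (X' : learner_class A' B') (Y' : learner_class B' C') :
  class_tensor (class_comp X Y) (class_comp X' Y')
  = class_comp (class_tensor X X') (class_tensor Y Y').
Proof.
rewrite -(reprK X) -(reprK Y) -(reprK X') -(reprK Y').
rewrite !(class_compE, class_tensorE).
apply: classof_eq; exists (@interchange _ _ _ _); split; last by [].
by exists (@interchange _ _ _ _) => -[[? ?] [? ?]].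
Qed.

Lemma class_associator_iso (A B C : Sets) :
  isomorphism Learn (class_associator A B C).
Proof. by apply: pure_iso => [[[]]|[? []]]. Qed.

Lemma class_lunitor_iso (A : Sets) : isomorphism Learn (class_lunitor A).
Proof. by apply: pure_iso => [[[]]|]. Qed.

Lemma class_runitor_iso (A : Sets) : isomorphism Learn (class_runitor A).
Proof. by apply: pure_iso => [[? []]|]. Qed.

Lemma class_associator_natural (A A' B B' C C' : Sets)
    (X : learner_class A A') (Y : learner_class B B') (Z : learner_class C C') :
  class_comp (class_tensor (class_tensor X Y) Z) (class_associator A' B' C')
  = class_comp (class_associator A B C) (class_tensor X (class_tensor Y Z)).
Proof.
rewrite -(reprK X) -(reprK Y) -(reprK Z) !class_tensorE comp_purel comp_purer.
apply: classof_eq; exists (fun p => (p.1.1, (p.1.2, p.2))); split; last by [].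
by exists (fun p => ((p.1, p.2.1), p.2.2)) => [[[? ?] ?]|[? [? ?]]].
Qed.

(** After both unitors are absorbed, the two sides differ only by the one-point parameter factor
    coming from the identity on [oneset]. *)
Lemma class_lunitor_natural (A B : Sets) (X : learner_class A B) :
  class_comp (class_tensor (class_id oneset) X) (class_lunitor B)
  = class_comp (class_lunitor A) X.
Proof.
rewrite -(reprK X) class_tensorE comp_purel comp_purer.
apply: classof_eq; exists snd; split=> //.
exists (pair Rpow0_pt) => //.
by case=> p q; rewrite -(Rpow0_eq p).
Qed.

Lemma class_runitor_natural (A B : Sets) (X : learner_class A B) :
  class_comp (class_tensor X (class_id oneset)) (class_runitor B)
  = class_comp (class_runitor A) X.
Proof.
rewrite -(reprK X) class_tensorE comp_purel comp_purer.
apply: classof_eq; exists fst; split=> //.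
exists (pair^~ Rpow0_pt) => //.
by case=> p q; rewrite -(Rpow0_eq q).
Qed.

Lemma class_triangle (A B : Sets) :
  class_comp (class_associator A oneset B)
    (class_tensor (class_id A) (class_lunitor B))
  = class_tensor (class_runitor A) (class_id B).
Proof. by rewrite !pure_tensor pure_comp; apply: eq_pure. Qed.

(** Every arrow is pure, so the diagram reduces to one for the forward functions and one for the
    backward functions, both true by computation on projections. *)
Lemma class_pentagon (A B C D : Sets) :
  class_comp (class_associator (setprod A B) C D)
    (class_associator A B (setprod C D))
  = class_comp (class_tensor (class_associator A B C) (class_id D))
      (class_comp (class_associator A (setprod B C) D)
        (class_tensor (class_id A) (class_associator B C D))).
Proof. by rewrite !(pure_tensor, pure_comp); apply: eq_pure. Qed.

Definition Learn_monoidal : monoidal_structure Learn oneset setprod :=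
  @Monoidal _ _ Learn oneset setprod class_tensor
    class_associator class_lunitor class_runitor
    class_tensor_id class_tensor_comp
    class_associator_iso class_lunitor_iso class_runitor_iso
    class_associator_natural class_lunitor_natural class_runitor_natural
    class_triangle class_pentagon.

(** * The symmetry *)

Definition class_braid (A B : Sets) :
    learner_class (setprod A B) (setprod B A) :=
  pure (@swap A B) (@swap B A).

(** Exchanging the two learners exchanges their parameter spaces, so [swap] also serves as the
    parameter bijection. *)
Lemma class_braid_natural (A A' B B' : Sets)
    (X : learner_class A A') (Y : learner_class B B') :
  class_comp (class_tensor X Y) (class_braid A' B')
  = class_comp (class_braid A B) (class_tensor Y X).
Proof.
rewrite -(reprK X) -(reprK Y) !class_tensorE comp_purel comp_purer.
apply: classof_eq; exists (@swap _ _); split; last by [].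
by exists (@swap _ _) => -[].
Qed.

Lemma class_braid_sym (A B : Sets) :
  class_comp (class_braid A B) (class_braid B A) = class_id (setprod A B).
Proof. by rewrite pure_comp; apply: eq_pure => -[]. Qed.

Lemma class_hexagon (A B C : Sets) :
  class_comp (class_associator A B C)
    (class_comp (class_braid A (setprod B C)) (class_associator B C A))
  = class_comp (class_tensor (class_braid A B) (class_id C))
      (class_comp (class_associator B A C)
        (class_tensor (class_id B) (class_braid A C))).
Proof. by rewrite !(pure_tensor, pure_comp); apply: eq_pure. Qed.

Definition Learn_symmetric : symmetric_structure Learn_monoidal :=
  @Symmetric _ _ Learn oneset setprod Learn_monoidal class_braid
    class_braid_natural class_braid_sym class_hexagon.

Theorem mainTheorem2 :
  exists (Learn : category learner_class)
         (M : monoidal_structure Learn oneset setprod)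
         (S : symmetric_structure M),
    [/\ forall (A B C : Sets) (l : learner A B) (m : learner B C),
          compose Learn (classof l) (classof m) = classof (learner_comp l m),
        forall A : Sets, idm Learn A = classof (learner_id A),
        forall (A B C D : Sets) (l : learner A B) (m : learner C D),
          tensor M (classof l) (classof m) = classof (learner_tensor l m)
      & forall A B : Sets, braid S A B = classof (learner_braid A B)].
Proof.
(* The clauses on identities and braidings hold by conversion: [learner_id] and [learner_braid]
   unfold to pure learners. *)
exists Learn, Learn_monoidal, Learn_symmetric; split=> //.
- exact: class_compE.
- exact: class_tensorE.
Qed.
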